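(* Let $N\ge 1$, let $|\psi_1\rangle,\dots,|\psi_N\rangle$ be unit vectors (pure states) in a finite-dimensional complex Hilbert space $\mathcal{H}$, and let $(p_1,\dots,p_N)$ be a probability distribution ($p_x\ge 0$, $\sum_{x=1}^N p_x=1$). Let $$P_{\mathrm s}^{*}=\max_{\{\hat M_x\}_{x=1}^N}\ \sum_{x=1}^N p_x\,\langle\psi_x|\hat M_x|\psi_x\rangle$$ be the optimal success probability of distinguishing the states, where the maximum is over all $N$-outcome generalized measurements $\{\hat M_x\}_{x=1}^N$ on $\mathcal{H}$. Then $$P_{\mathrm s}^{*}\ \ge\ \frac{2^{S\left(\sum_{x=1}^N p_x|\psi_x\rangle\langle\psi_x|\right)}}{N}.$$
   Context: All logarithms are base $2$, with the convention $0\log 0=0$. An $N$-outcome generalized measurement (POVM) on $\mathcal{H}$ is a family $\{\hat M_x\}_{x=1}^N$ of positive semidefinite operators on $\mathcal{H}$ with $\sum_{x=1}^N\hat M_x=\mathbb{1}$. The von Neumann entropy of a density operator (positive semidefinite operator of trace $1$) $\chi$ is $S(\chi)=-\mathrm{Tr}[\chi\log\chi]$. *)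

(* Defs.v *)
From HB Require Import structures.
From mathcomp Require Export all_boot all_order all_algebra.
From mathcomp Require Export spectral sesquilinear.
From mathcomp Require Export complex.
From mathcomp Require Export classical_sets reals exp.

Set Implicit Arguments.
Unset Strict Implicit.
Unset Printing Implicit Defensive.

Import Order.TTheory GRing.Theory Num.Theory.

Local Open Scope classical_set_scope.
Local Open Scope ring_scope.
Local Open Scope sesquilinear_scope.
Local Open Scope complex_scope.

(* A d-dimensional complex Hilbert space is modelled, through the choice of an
   orthonormal basis, as the space 'cV[R[i]]_d of column vectors; operators are
   square matrices and M ^t* is the adjoint of M. *)

Section QuantumStates.
Variables (R : realType) (d : nat).
Implicit Types (v : 'cV[R[i]]_d) (A M : 'M[R[i]]_d).

(* <v|A|v> *)
Definition expval v A : R[i] := (v ^t* *m A *m v) 0 0.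

Definition unit_vector v : Prop := (v ^t* *m v) 0 0 = 1.

(* |v><v| *)
Definition ket_bra v : 'M[R[i]]_d := v *m v ^t*.

(* In R[i], 0 <= z means that z is real and nonnegative; in particular such an
   A is Hermitian. *)
Definition psdmx A : Prop := forall v, 0 <= expval v A.

Definition is_povm N (M : 'I_N -> 'M[R[i]]_d) : Prop :=
  (forall x, psdmx (M x)) /\ \sum_(x < N) M x = 1%:M.

Definition log2 (x : R) : R := ln x / ln 2.

(* Functional calculus: for A = P^-1 *m diag_mx D *m P with P unitary and D
   real, this is P^-1 *m diag_mx (log2 D) *m P. As ln 0 = 0, the kernel of A
   is mapped to 0, so that A *m logmx A obeys the convention 0 log 0 = 0. *)
Definition logmx A : 'M[R[i]]_d :=
  invmx (spectralmx A)
    *m diag_mx (map_mx (fun z => (log2 (complex.Re z))%:C) (spectral_diag A))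
    *m spectralmx A.

(* The trace is real when A is a density operator. *)
Definition vn_entropy A : R := - complex.Re (\tr (A *m logmx A)).

Definition ensemble_state N (p : 'I_N -> R) (psi : 'I_N -> 'cV[R[i]]_d) :
    'M[R[i]]_d :=
  \sum_(x < N) (p x)%:C *: ket_bra (psi x).

(* expval (psi x) (M x) is real when M is a POVM. *)
Definition success_prob N (p : 'I_N -> R) (psi : 'I_N -> 'cV[R[i]]_d)
    (M : 'I_N -> 'M[R[i]]_d) : R :=
  \sum_(x < N) p x * complex.Re (expval (psi x) (M x)).

(* Ps is the maximum, attained, of the success probability over all POVMs. *)
Definition is_optimal_success N (p : 'I_N -> R) (psi : 'I_N -> 'cV[R[i]]_d)
    (Ps : R) : Prop :=
  let probs := [set success_prob p psi M | M in @is_povm N] in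
  probs Ps /\ ubound probs Ps.

End QuantumStates.

(* Main.v *)
From HB Require Import structures.
Require Import Defs.
From mathcomp Require Import boolp topology normedtype derive.
From mathcomp Require Import ring lra.

(** The bound is achieved by the pretty good measurement, with operators
    p_x T |psi_x><psi_x| T where rho is the ensemble state and T = rho^{-1/2}
    on the support of rho.  Its success probability is at least the sum of
    the squares of a_x = p_x <psi_x|T|psi_x>, and the a_x sum up to
    Tr (T rho) = Tr (sqrt rho), so by Cauchy-Schwarz it is at least (Tr (sqrt rho))^2 / N.
    Now 2 log2 (Tr (sqrt rho)) is the Renyi entropy of order 1/2 of rho, which
    dominates its von Neumann entropy.  The optimum is attained because the
    POVMs form a compact set on which the success probability is continuous. *)

Set Implicit Arguments.
Unset Strict Implicit.
Unset Printing Implicit Defensive.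

Import Order.TTheory GRing.Theory Num.Theory.
Import numFieldNormedType.Exports.

Local Open Scope ring_scope.
Local Open Scope sesquilinear_scope.
Local Open Scope complex_scope.

(** * Adjoints, expectation values and spectral calculus *)

Lemma adjmxM (C : numClosedFieldType) m n k (A : 'M[C]_(m, n)) (B : 'M_(n, k)) :
  (A *m B) ^t* = B ^t* *m A ^t*.
Proof. by rewrite trmx_mul map_mxM. Qed.

Lemma adjmxE (C : numClosedFieldType) m n (A : 'M[C]_(m, n)) i j :
  (A ^t*) i j = (A j i)^*%R.
Proof. by rewrite !mxE. Qed.

Section Operators.
Variables (R : realType) (d : nat).
Implicit Types (v w : 'cV[R[i]]_d) (A B U : 'M[R[i]]_d) (f g : 'I_d -> R).

Lemma expval_trace v A : expval v A = \tr (A *m ket_bra v).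
Proof.
rewrite /expval /ket_bra mulmxA mxtrace_mulC mulmxA.
by rewrite /mxtrace big_ord1.
Qed.

Lemma expvalD v A B : expval v (A + B) = expval v A + expval v B.
Proof. by rewrite !expval_trace mulmxDl linearD. Qed.

Lemma expvalZ v c A : expval v (c *: A) = c * expval v A.
Proof. by rewrite !expval_trace -scalemxAl linearZ. Qed.

Lemma expval_sum v n (F : 'I_n -> 'M[R[i]]_d) :
  expval v (\sum_(x < n) F x) = \sum_(x < n) expval v (F x).
Proof.
rewrite expval_trace mulmx_suml linear_sum.
by apply: eq_bigr => x _; rewrite expval_trace.
Qed.

Lemma expval_ket_bra v w : expval v (ket_bra w) = `|(v ^t* *m w) 0 0| ^+ 2.
Proof.
rewrite /expval /ket_bra mulmxA -mulmxA mxE big_ord1 normCK; congr (_ * _).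
have -> : w ^t* *m v = (v ^t* *m w) ^t* by rewrite adjmxM trmxCK.
by rewrite adjmxE.
Qed.

Lemma psdmxD A B : psdmx A -> psdmx B -> psdmx (A + B).
Proof. by move=> hA hB v; rewrite expvalD addr_ge0. Qed.

Lemma psdmxZ (c : R) A : 0 <= c -> psdmx A -> psdmx (c%:C *: A).
Proof. by move=> hc hA v; rewrite expvalZ mulr_ge0 ?ler0c. Qed.

Lemma psdmx_ket_bra w : psdmx (ket_bra w).
Proof. by move=> v; rewrite expval_ket_bra exprn_ge0. Qed.

Lemma psdmx_sum n (F : 'I_n -> 'M[R[i]]_d) :
  (forall x, psdmx (F x)) -> psdmx (\sum_(x < n) F x).
Proof.
by move=> hF v; rewrite expval_sum; apply: sumr_ge0 => x _; apply: hF.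
Qed.

Lemma ket_bra_mulmx A v : ket_bra (A *m v) = A *m ket_bra v *m A ^t*.
Proof. by rewrite /ket_bra adjmxM !mulmxA. Qed.

(** For unitary [U], the Hermitian operator with eigenvalues [f i] and eigenvectors the columns of
    [U ^t*], as in the convention of [spectralmx]. All functions of the ensemble state are taken in
    this form with one common [U], so products and traces reduce to real arithmetic on
    eigenvalues. *)
Definition spectral_op U f : 'M[R[i]]_d :=
  U ^t* *m diag_mx (\row_i (f i)%:C) *m U.

Lemma adj_spectral_op U f : (spectral_op U f) ^t* = spectral_op U f.
Proof.
rewrite /spectral_op 2!adjmxM trmxCK mulmxA tr_diag_mx map_diag_mx.
suff -> : (\row_i (f i)%:C) ^ Num.conj = \row_i (f i)%:C by [].
by apply/rowP => i; rewrite !mxE; apply: conjc_real.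
Qed.

Lemma eq_spectral_op U f g : f =1 g -> spectral_op U f = spectral_op U g.
Proof.
move=> fg; rewrite /spectral_op.
suff -> : \row_i (f i)%:C = \row_i (g i)%:C by [].
by apply/rowP => i; rewrite !mxE fg.
Qed.

Lemma spectral_opM U f g : U \is unitarymx ->
  spectral_op U f *m spectral_op U g = spectral_op U (fun i => f i * g i).
Proof.
move=> /unitarymxP hU; rewrite /spectral_op -!mulmxA (mulmxA U) hU mul1mx.
rewrite (mulmxA (diag_mx _)) mulmx_diag.
suff -> : \row_i ((\row_i0 (f i0)%:C) 0 i * (\row_i0 (g i0)%:C) 0 i)
  = \row_i (f i * g i)%:C by [].
by apply/rowP => i; rewrite !mxE rmorphM.
Qed.

Lemma spectral_op1 U : U \is unitarymx -> spectral_op U (fun=> 1) = 1%:M.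
Proof.
move=> /unitarymxP hU; rewrite /spectral_op.
have -> : diag_mx (\row_i 1%:C) = 1%:M :> 'M[R[i]]_d.
  by apply/matrixP => i j; rewrite !mxE.
by rewrite mulmx1; apply: mulmx1C.
Qed.

Lemma spectral_opB U f g :
  spectral_op U f - spectral_op U g = spectral_op U (fun i => f i - g i).
Proof.
rewrite /spectral_op -mulmxBl -mulmxBr -linearB /=.
suff -> : \row_i (f i)%:C - \row_i (g i)%:C = \row_i (f i - g i)%:C by [].
by apply/rowP => i; rewrite !mxE rmorphB.
Qed.

Lemma mxtrace_spectral_op U f : U \is unitarymx ->
  \tr (spectral_op U f) = (\sum_i f i)%:C.
Proof.
move=> /unitarymxP hU; rewrite /spectral_op mxtrace_mulC mulmxA hU mul1mx.
by rewrite mxtrace_diag rmorph_sum; apply: eq_bigr => i _; rewrite mxE.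
Qed.

Lemma expval_spectral_op U f v :
  expval v (spectral_op U f) = \sum_i (f i)%:C * `|(U *m v) i 0| ^+ 2.
Proof.
rewrite /expval /spectral_op !mulmxA -mulmxA -adjmxM mul_mx_diag mxE.
apply: eq_bigr => i _; rewrite mxE adjmxE [X in _ * X * _]mxE normCK; ring.
Qed.

Lemma psdmx_spectral_op U f : (forall i, 0 <= f i) -> psdmx (spectral_op U f).
Proof.
move=> hf v; rewrite expval_spectral_op; apply: sumr_ge0 => i _.
by rewrite mulr_ge0 ?ler0c ?exprn_ge0.
Qed.

Lemma psdmx_spectral A : A ^t* = A -> psdmx A -> exists f,
  [/\ forall i, 0 <= f i, A = spectral_op (spectralmx A) f
    & logmx A = spectral_op (spectralmx A) (fun i => log2 (f i))].
Proof.
move=> hA pA; set U := spectralmx A; pose D := spectral_diag A.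
have hU : U \is unitarymx by exact: spectral_unitarymx.
have AE : A = U ^t* *m diag_mx D *m U.
  have /orthomx_spectralP : A \is normalmx by apply/normalmxP; rewrite hA.
  by rewrite invmx_unitary.
have D0 i : 0 <= D 0 i.
  (* The test vector is the [i]-th eigenvector, at which the expectation of [A] is its eigenvalue
     [D 0 i]. Being nonnegative in [R[i]], this eigenvalue is real and equals its real part. *)
  have := pA (U ^t* *m delta_mx i 0).
  rewrite {1}AE /expval adjmxM trmxCK !mulmxA.
  move/unitarymxP: (hU) => hU'.
  rewrite -(mulmxA _ U) hU' mulmx1 -(mulmxA _ U) hU' mulmx1.
  suff -> : (delta_mx i 0) ^t* *m diag_mx D *m delta_mx i 0 = (D 0 i)%:M :> 'M_1.
    by rewrite mxE eqxx mulr1n.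
  rewrite mul_mx_diag; apply/matrixP => a b; rewrite !ord1 !mxE eqxx mulr1n.
  rewrite (bigD1 i) //= !mxE !eqxx /= big1 ?addr0; last first.
    by move=> j ji; rewrite !mxE (negPf ji) mulr0.
  by rewrite conjC1 mul1r mulr1.
exists (fun i => complex.Re (D 0 i)).
have DE i : (complex.Re (D 0 i))%:C = D 0 i by rewrite RRe_real ?ger0_real.
split.
- by move=> i; rewrite -ler0c DE.
- rewrite /spectral_op {1}AE.
  suff <- : D = \row_i (complex.Re (D 0 i))%:C by [].
  by apply/rowP => i; rewrite mxE DE.
- rewrite /logmx /spectral_op -/U -/D invmx_unitary //.
  suff -> : map_mx (fun z => (log2 (complex.Re z))%:C) D
    = \row_i (log2 (complex.Re (D 0 i)))%:C by [].
  by apply/rowP => i; rewrite !mxE.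
Qed.

End Operators.

(** * Cauchy-Schwarz and the comparison of Shannon and Renyi entropies *)

Section Inequalities.
Variable R : realType.

(** The difference of the two sides is half the sum of [(a i - a j) ^+ 2] over all pairs. *)
Lemma sqr_sum_le n (a : 'I_n -> R) :
  (\sum_i a i) ^+ 2 <= n%:R * \sum_i a i ^+ 2.
Proof.
have : 0 <= \sum_i \sum_j (a i - a j) ^+ 2.
  by apply: sumr_ge0 => i _; apply: sumr_ge0 => j _; apply: sqr_ge0.
have -> : \sum_i \sum_j (a i - a j) ^+ 2
  = 2 * (n%:R * \sum_i a i ^+ 2 - (\sum_i a i) ^+ 2).
  transitivity (\sum_i (n%:R * a i ^+ 2 + \sum_j a j ^+ 2
      - 2 * a i * \sum_j a j)).
    apply: eq_bigr => i _.
    rewrite (eq_bigr (fun j => a i ^+ 2 + a j ^+ 2 - 2 * a i * a j)); last first.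
      by move=> j _; ring.
    rewrite !big_split /= sumr_const card_ord sumrN -mulr_sumr.
    by rewrite -[X in X + _ - _]mulr_natl.
  rewrite !big_split /= sumr_const card_ord sumrN -mulr_sumr -mulr_suml.
  by rewrite -mulr_sumr -[X in _ + X - _]mulr_natl; ring.
by lra.
Qed.

(** In logarithmic form this is Jensen's inequality for [ln]: the mean of [ln (1 / sqrt (f i))]
    under the weights [f i] is at most [ln s], where [s] is the sum of the square roots. *)
Lemma shannon_le_renyi_half n (f : 'I_n -> R) :
    (forall i, 0 <= f i) -> \sum_i f i = 1 ->
  2 `^ (- \sum_i f i * log2 (f i)) <= (\sum_i Num.sqrt (f i)) ^+ 2.
Proof.
move=> f0 f1; set s := \sum_i _.
(* This excludes [s = 0], so that [ln s] and the division by [s] below are meaningful. *)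
have s1 : 1 <= s ^+ 2.
  have le_fs i : f i <= s * Num.sqrt (f i).
    rewrite -{1}(sqr_sqrtr (f0 i)) expr2 ler_wpM2r ?sqrtr_ge0 //.
    rewrite /s (bigD1 i) //= lerDl; apply: sumr_ge0 => j _; exact: sqrtr_ge0.
  by rewrite -{1}f1 expr2 {2}/s mulr_sumr; apply: ler_sum => i _; apply: le_fs.
have s0 : 0 < s.
  have : 0 <= s by apply: sumr_ge0 => i _; apply: sqrtr_ge0.
  rewrite le_eqVlt => /orP[/eqP s0|//].
  by move: s1; rewrite -s0 expr0n /= ler10.
rewrite /powR pnatr_eq0 /= -ler_ln ?posrE ?expR_gt0 ?exprn_gt0 // expRK.
rewrite lnXn // mulNr mulr_suml.
have -> : \sum_i f i * log2 (f i) * ln 2 = \sum_i f i * ln (f i).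
  apply: eq_bigr => i _; rewrite /log2 -mulrA divfK //.
  by rewrite gt_eqF // ln_gt0 // ltr1n.
(* Tangent line bound [ln t <= t - 1] at [t = 1 / (s * sqrt (f i))]. *)
have key i : - (f i * ln (f i)) - 2 * f i * ln s
             <= 2 * (Num.sqrt (f i) / s - f i).
  have := f0 i; rewrite le_eqVlt => /orP[/eqP <-|fi0].
    by rewrite sqrtr0 !(mul0r, mulr0, oppr0, addr0).
  have q0 : 0 < Num.sqrt (f i) by rewrite sqrtr_gt0.
  have fE : f i = Num.sqrt (f i) ^+ 2 by rewrite sqr_sqrtr.
  set q := Num.sqrt (f i) in q0 fE *.
  have t0 : 0 < (s * q)^-1 by rewrite invr_gt0 mulr_gt0.
  have := @le_ln1Dx R ((s * q)^-1 - 1); rewrite ltrBrDr addNr t0 => /(_ isT).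
  rewrite addrC subrK lnV ?posrE ?mulr_gt0 // lnM ?posrE // => h.
  have -> : q / s = q ^+ 2 * (s * q)^-1 by field; rewrite !gt_eqF.
  rewrite fE lnXn // -mulr_natl.
  (* Weighting by [f i = q ^+ 2] makes the right-hand sides sum up to [2 * (s / s - 1) = 0]. *)
  have := ler_wpM2l (sqr_ge0 q) h.
  by lra.
have : \sum_i (- (f i * ln (f i)) - 2 * f i * ln s)
       <= \sum_i 2 * (Num.sqrt (f i) / s - f i).
  by apply: ler_sum => i _; apply: key.
rewrite big_split /= !sumrN -mulr_suml -!mulr_sumr f1 mulr1.
rewrite big_split /= sumrN -mulr_suml -/s f1 divff ?gt_eqF // subrr mulr0.
by rewrite -[_ *+ 2]mulr_natl; lra.
Qed.

End Inequalities.

(** * The pretty good measurement and its success probability *)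

Section PrettyGood.
Variables (R : realType) (d N : nat).
Variables (p : 'I_N -> R) (psi : 'I_N -> 'cV[R[i]]_d).
Hypothesis p_ge0 : forall x, 0 <= p x.

Let rho := ensemble_state p psi.

Lemma adj_ensemble_state : rho ^t* = rho.
Proof.
rewrite /rho /ensemble_state; apply/matrixP => i j.
rewrite adjmxE !summxE rmorph_sum; apply: eq_bigr => x _.
rewrite !mxE rmorphM /=; congr (_ * _); first exact: conjc_real.
rewrite !big_ord1 rmorphM /= !adjmxE conjCK; exact: mulrC.
Qed.

Lemma psdmx_ensemble_state : psdmx rho.
Proof.
by apply: psdmx_sum => x; apply: psdmxZ => //; apply: psdmx_ket_bra.
Qed.

(** Applied with the identity to get the trace of [rho], and with [T] to get the sum of the
    [a x]. *)
Lemma mxtrace_mul_ensemble_state A :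
  \tr (A *m rho) = \sum_x (p x)%:C * expval (psi x) A.
Proof.
rewrite mulmx_sumr linear_sum; apply: eq_bigr => x _ /=.
by rewrite -scalemxAr linearZ expval_trace.
Qed.

Lemma mxtrace_ensemble_state : (forall x, unit_vector (psi x)) ->
  \tr rho = (\sum_x p x)%:C.
Proof.
move=> psi1; rewrite -[rho]mul1mx mxtrace_mul_ensemble_state rmorph_sum.
by apply: eq_bigr => x _ /=; rewrite /expval mulmx1 psi1 mulr1.
Qed.

Lemma exists_pretty_good : (0 < N)%N -> (forall x, unit_vector (psi x)) ->
    \sum_x p x = 1 ->
  exists2 M, @is_povm R d N M
    & 2 `^ (vn_entropy rho) / N%:R <= success_prob p psi M.
Proof.
move=> N0 psi1 p1; pose x0 : 'I_N := Ordinal N0.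
have [f [f0 rhoE logE]] :=
  psdmx_spectral adj_ensemble_state psdmx_ensemble_state.
set U := spectralmx rho in rhoE logE.
have hU : U \is unitarymx by exact: spectral_unitarymx.
(* As 0^-1 = 0, T vanishes on the kernel of rho. *)
pose g i := (Num.sqrt (f i))^-1; pose T := spectral_op U g.
have adjT : T ^t* = T by exact: adj_spectral_op.
(* The pretty good operators sum up to the projector T rho T on the support of
   rho; the complementary projector Q is added to one of them. *)
pose Q := 1%:M - T *m rho *m T.
(* The eigenvalue [g i * f i * g i] of [T *m rho *m T] is 1 on the support of [rho] and 0 on its
   kernel, so those of [Q] are 0 or 1. *)
have QE : Q = spectral_op U (fun i => 1 - (f i != 0)%:R).
  rewrite /Q -(spectral_op1 hU) rhoE !spectral_opM // spectral_opB.
  apply: eq_spectral_op => i; congr (1 - _); rewrite /g.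
  have [->|fi0] := eqVneq (f i) 0; first by rewrite mulr0 mul0r.
  have sq0 : Num.sqrt (f i) != 0.
    by rewrite gt_eqF // sqrtr_gt0 lt_neqAle eq_sym fi0 f0.
  by rewrite -{2}(sqr_sqrtr (f0 i)) /= mulr1n; field.
have psdQ : psdmx Q.
  rewrite QE; apply: psdmx_spectral_op => i.
  by case: (f i != 0); rewrite ?subrr ?subr0.
pose M x := (p x)%:C *: ket_bra (T *m psi x) + (if x == x0 then Q else 0).
have psd0 : psdmx (0 : 'M[R[i]]_d).
  by move=> v; rewrite /expval mulmx0 mul0mx mxE.
have povmM : is_povm M.
  split=> [x|].
    apply: psdmxD; first by apply: psdmxZ => //; apply: psdmx_ket_bra.
    by case: ifP.
  rewrite big_split /= -big_mkcond big_pred1_eq /Q.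
  suff -> : \sum_x (p x)%:C *: ket_bra (T *m psi x) = T *m rho *m T.
    by rewrite addrCA subrr addr0.
  rewrite mulmx_sumr mulmx_suml; apply: eq_bigr => x _.
  by rewrite ket_bra_mulmx adjT -scalemxAr -scalemxAl.
exists M => //.
pose a x := p x * complex.Re (expval (psi x) T).
have aC x : (a x)%:C = (p x)%:C * expval (psi x) T.
  rewrite /a rmorphM /= RRe_real // ger0_real //.
  by apply: psdmx_spectral_op => i; rewrite invr_ge0 sqrtr_ge0.
have sum_a : \sum_x a x = \sum_i Num.sqrt (f i).
  apply: complexI; rewrite rmorph_sum (eq_bigr _ (fun x _ => aC x)).
  rewrite -mxtrace_mul_ensemble_state rhoE spectral_opM //.
  rewrite mxtrace_spectral_op //; congr (_%:C); apply: eq_bigr => i _; rewrite /g.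
  have [->|fi0] := eqVneq (f i) 0; first by rewrite sqrtr0 mulr0.
  have sq0 : Num.sqrt (f i) != 0.
    by rewrite gt_eqF // sqrtr_gt0 lt_neqAle eq_sym fi0 f0.
  by rewrite -{2}(sqr_sqrtr (f0 i)); field.
(* The rank-one part of [M x] contributes exactly [a x ^+ 2]; the possible extra term [Q] only
   increases the value. *)
have le_a x : a x ^+ 2 <= p x * complex.Re (expval (psi x) (M x)).
  rewrite -lecR [X in _ <= X]rmorphM /= RRe_real; last first.
    exact/ger0_real/(povmM.1 x).
  rewrite expvalD mulrDr expvalZ expval_ket_bra.
  have -> : ((psi x) ^t* *m (T *m psi x)) 0 0 = expval (psi x) T.
    by rewrite mulmxA.
  have -> : (p x)%:C * ((p x)%:C * `|expval (psi x) T| ^+ 2) = (a x ^+ 2)%:C.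
    rewrite rmorphXn /= aC ger0_norm; first by ring.
    by apply: psdmx_spectral_op => i; rewrite invr_ge0 sqrtr_ge0.
  rewrite lerDl mulr_ge0 ?ler0c //.
  by case: ifP => _; [apply: psdQ | apply: psd0].
have f1 : \sum_i f i = 1.
  apply: complexI; rewrite -(mxtrace_spectral_op _ hU) -rhoE.
  by rewrite mxtrace_ensemble_state // p1.
have -> : vn_entropy rho = - \sum_i f i * log2 (f i).
  rewrite /vn_entropy logE {1}rhoE spectral_opM // mxtrace_spectral_op //.
have N0R : 0 < N%:R :> R by rewrite ltr0n.
rewrite ler_pdivrMr // mulrC.
apply: le_trans (shannon_le_renyi_half f0 f1) _.
rewrite -sum_a; apply: le_trans (sqr_sum_le a) _.
by apply: ler_wpM2l; [apply: ltW | apply: ler_sum].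
Qed.

End PrettyGood.

(** * Real coordinates for families of operators, and closedness of the POVMs *)

Section Compactness.
Local Open Scope classical_set_scope.
Variable R : realType.

Lemma scalar_rV_continuous n (f : 'rV[R]_n -> R) : scalar f -> continuous f.
Proof.
move=> lin_f.
pose F : {scalar 'rV[R]_n} :=
  HB.pack f (GRing.isLinear.Build R 'rV[R]_n R *%R f lin_f).
have -> : f = fun v => \sum_(j < n) v 0 j * f (delta_mx 0 j).
  apply/boolp.funext => v; rewrite {1}[v]row_sum_delta -[f]/(F : _ -> _).
  by rewrite linear_sum; apply: eq_bigr => j _; rewrite linearZ.
apply: continuous_big => [|j _ v]; first exact: add_continuous.
by apply: continuousM; [exact: coord_continuous | exact: cst_continuous].
Qed.

(** Heine-Borel: [A] is a closed subset of a product of segments. *)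
Lemma rV_bounded_compact n (A : set 'rV[R]_n) (c : R) :
  (forall v, A v -> forall j, `|v 0 j| <= c) -> closed A -> compact A.
Proof.
move=> bA clA.
have cK : compact [set v : 'rV[R]_n | forall j, `[- c, c]%classic (v 0 j)].
  apply: (@rV_compact _ _ (fun=> `[- c, c]%classic)) => j.
  exact: segment_compact.
apply: subclosed_compact clA cK _ => v Av j /=.
by rewrite in_itv /= -ler_norml bA.
Qed.

Lemma closed_le_continuous (T : topologicalType) (f : T -> R) c :
  continuous f -> closed [set v | c <= f v].
Proof.
move=> cf; apply: (preimage_closed (f := f)) (@closed_ge R c) => v _.
exact: cf.
Qed.

Lemma closed_eq_continuous (T : topologicalType) (f : T -> R) c :
  continuous f -> closed [set v | f v = c].
Proof.
move=> cf; apply: (preimage_closed (f := f)) (@closed_eq R c) => v _.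
exact: cf.
Qed.

Variables d N : nat.
Implicit Types (M : 'I_N -> 'M[R[i]]_d).

Let T := ('I_N * 'I_d * 'I_d * bool)%type.

(** Families of complex matrices are flattened to real row vectors, where Heine-Borel applies; the
    boolean in the index selects the imaginary part. *)
Definition povm_decode (v : 'rV[R]_#|{: T}|) x : 'M[R[i]]_d :=
  \matrix_(i, j) (v 0 (enum_rank (x, i, j, false))
                  +i* v 0 (enum_rank (x, i, j, true))).

Definition povm_encode M : 'rV[R]_#|{: T}| :=
  \row_k let: (x, i, j, b) := enum_val k in
    if b then complex.Im (M x i j) else complex.Re (M x i j).

Lemma povm_encodeK M : povm_decode (povm_encode M) =1 M.
Proof.
move=> x; apply/matrixP => i j; rewrite !mxE !enum_rankK /=.
by case: (M x i j).
Qed.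

Lemma povm_decode_linear a v w x :
  povm_decode (a *: v + w) x = a%:C *: povm_decode v x + povm_decode w x.
Proof. by apply/matrixP => i j; rewrite !mxE /=; simpc. Qed.

Lemma Re_scalarD (a : R) (z w : R[i]) :
  complex.Re (a%:C * z + w) = a * complex.Re z + complex.Re w.
Proof. by case: z w => [z1 z2] [w1 w2] /=; rewrite mul0r subr0. Qed.

Lemma Im_scalarD (a : R) (z w : R[i]) :
  complex.Im (a%:C * z + w) = a * complex.Im z + complex.Im w.
Proof. by case: z w => [z1 z2] [w1 w2] /=; rewrite mul0r addr0. Qed.

Lemma Re_expval_decode_continuous x u :
  continuous (fun v => complex.Re (expval u (povm_decode v x))).
Proof.
apply: scalar_rV_continuous => a v w.
by rewrite povm_decode_linear expvalD expvalZ Re_scalarD.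
Qed.

Lemma Im_expval_decode_continuous x u :
  continuous (fun v => complex.Im (expval u (povm_decode v x))).
Proof.
apply: scalar_rV_continuous => a v w.
by rewrite povm_decode_linear expvalD expvalZ Im_scalarD.
Qed.

Lemma success_prob_decode_continuous (p : 'I_N -> R) psi :
  continuous (fun v => success_prob p psi (povm_decode v)).
Proof.
apply: continuous_big => [|x _ v]; first exact: add_continuous.
apply: continuousM; first exact: cst_continuous.
exact: Re_expval_decode_continuous.
Qed.

(** Being a POVM is a conjunction of equalities and weak inequalities between real linear forms in
    [v] and constants: two for each outcome and test vector, since nonnegativity in [R[i]] includes
    a vanishing imaginary part, and two for each entry of the sum. *)
Lemma closed_povm_decode : closed [set v | is_povm (povm_decode v)].
Proof.
have -> : [set v | is_povm (povm_decode v)] =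
   (\bigcap_(xu in [set: 'I_N * 'cV[R[i]]_d])
      ([set v | 0 <= complex.Re (expval xu.2 (povm_decode v xu.1))] `&`
       [set v | complex.Im (expval xu.2 (povm_decode v xu.1)) = 0])) `&`
   (\bigcap_(ij in [set: 'I_d * 'I_d])
      ([set v | \sum_x complex.Re (povm_decode v x ij.1 ij.2)
                 = complex.Re ((1%:M : 'M[R[i]]_d) ij.1 ij.2)] `&`
       [set v | \sum_x complex.Im (povm_decode v x ij.1 ij.2)
                 = complex.Im ((1%:M : 'M[R[i]]_d) ij.1 ij.2)])).
  apply/seteqP; split=> v /=.
    move=> [psd sum1]; split=> [[x u] _ /=|[i j] _ /=].
      by have := psd x u; rewrite lecE /= => /andP[/eqP].
    by rewrite -sum1 summxE !raddf_sum.
  move=> [psd sum1]; split=> [x u|].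
    by have [] := psd (x, u) I; rewrite lecE /= => -> ->; rewrite eqxx.
  apply/matrixP => i j; have [/= re im] := sum1 (i, j) I.
  by apply/eqP; rewrite eq_complex summxE !raddf_sum re im !eqxx.
apply: closedI; apply: closed_bigI => -[x u] _ /=; apply: closedI.
- by apply: closed_le_continuous; apply: Re_expval_decode_continuous.
- by apply: closed_eq_continuous; apply: Im_expval_decode_continuous.
- apply: closed_eq_continuous; apply: scalar_rV_continuous => a v w.
  rewrite mulr_sumr -big_split; apply: eq_bigr => y _ /=.
  by rewrite povm_decode_linear !mxE Re_scalarD.
- apply: closed_eq_continuous; apply: scalar_rV_continuous => a v w.
  rewrite mulr_sumr -big_split; apply: eq_bigr => y _ /=.
  by rewrite povm_decode_linear !mxE Im_scalarD.
Qed.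

End Compactness.

(** * Boundedness of the POVMs and attainment of the optimum *)

Section Maximum.
Local Open Scope classical_set_scope.
Variables (R : realType) (d : nat).
Implicit Types (A : 'M[R[i]]_d).

Lemma delta_mulmx_delta A i j :
  ((delta_mx i 0 : 'cV_d) ^t* *m A *m delta_mx j 0 :> 'M_1) 0 0 = A i j.
Proof.
by rewrite trmx_delta map_delta_mx -rowE -colE !mxE.
Qed.

Lemma expval_delta A i : expval (delta_mx i 0) A = A i i.
Proof. exact: delta_mulmx_delta. Qed.

Lemma expval_deltaD A i j (c : R[i]) :
  expval (delta_mx i 0 + c *: delta_mx j 0) A =
    A i i + c^*%R * c * A j j + c * A i j + c^*%R * A j i.
Proof.
have adjD : (delta_mx i 0 + c *: delta_mx j 0) ^t*
    = (delta_mx i 0) ^t* + c^*%R *: (delta_mx j 0) ^t* :> 'rV_d.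
  by rewrite linearD linearZ /= map_mxD map_mxZ.
rewrite /expval adjD mulmxDl mulmxDr !mulmxDl -!scalemxAl -!scalemxAr.
have entryD (B C : 'M[R[i]]_1) : (B + C) 0 0 = B 0 0 + C 0 0 by rewrite mxE.
have entryZ a (B : 'M[R[i]]_1) : (a *: B) 0 0 = a * B 0 0 by rewrite mxE.
by rewrite !(entryD, entryZ, delta_mulmx_delta); ring.
Qed.

(** Positivity is tested on the vectors [e_i + c e_j] with [c] among 1, -1, i and -i. The imaginary
    parts force [A j i] to be the conjugate of [A i j]; the real parts then bound twice each
    component of [A i j] by the sum of the two diagonal entries. *)
Lemma psdmx_entry_bound A i j :
    psdmx A -> complex.Re (A i i) <= 1 -> complex.Re (A j j) <= 1 ->
  `|complex.Re (A i j)| <= 1 /\ `|complex.Im (A i j)| <= 1.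
Proof.
move=> psdA Ai Aj.
have q c : 0 <= A i i + c^*%R * c * A j j + c * A i j + c^*%R * A j i.
  by rewrite -expval_deltaD; apply: psdA.
have := q (1 +i* 0); have := q ((-1) +i* 0).
have := q (0 +i* 1); have := q (0 +i* (-1)).
move: Ai Aj; case: (A i i) (A j j) (A i j) (A j i) =>
  [a1 a2] [b1 b2] [x1 x2] [y1 y2] /= Ai Aj.
rewrite !lecE /= => /andP[/eqP h1 h2] /andP[/eqP h3 h4].
move=> /andP[/eqP h5 h6] /andP[/eqP h7 h8].
by rewrite !ler_norml; split; apply/andP; split; lra.
Qed.

(** The [(i, i)] entries over all outcomes are nonnegative and sum up to 1. *)
Lemma povm_diag_le1 N (M : 'I_N -> 'M[R[i]]_d) x i :
  is_povm M -> complex.Re (M x i i) <= 1.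
Proof.
move=> [psdM sumM].
have M0 y : 0 <= complex.Re (M y i i).
  by have := psdM y (delta_mx i 0); rewrite expval_delta lecE /= => /andP[].
have : \sum_y complex.Re (M y i i) = 1.
  by rewrite -(raddf_sum (@complex.Re R)) -summxE sumM mxE eqxx.
by rewrite (bigD1 x) //= => <-; rewrite lerDl sumr_ge0.
Qed.

(** Extreme value theorem on the compact set of encoded POVMs; the hypothesis provides its
    nonemptiness. *)
Lemma exists_optimal_success N (p : 'I_N -> R) (psi : 'I_N -> 'cV[R[i]]_d) :
    (exists M, @is_povm R d N M) ->
  exists Ps, is_optimal_success p psi Ps.
Proof.
move=> [M0 povmM0].
pose K := [set v | is_povm (@povm_decode R d N v)].
have KE M : is_povm M -> K (povm_encode M).
  by move=> povmM; rewrite /K /= (boolp.funext (povm_encodeK M)).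
have cK : compact K.
  apply: (@rV_bounded_compact _ _ _ 1) (@closed_povm_decode R d N) => v Kv k.
  rewrite -(enum_valK k); case: (enum_val k) => [[[x i] j] b].
  have [] := @psdmx_entry_bound (povm_decode v x) i j (Kv.1 x)
    (povm_diag_le1 _ _ Kv) (povm_diag_le1 _ _ Kv).
  by rewrite !mxE /=; case: b.
pose F v := success_prob p psi (povm_decode v).
have [] := @compact_EVT_max _ R F K _ cK.
- by exists (povm_encode M0); apply: KE.
- by apply: continuous_subspaceT; apply: success_prob_decode_continuous.
move=> v /set_mem Kv vmax; exists (success_prob p psi (povm_decode v)).
split; first by exists (povm_decode v).
move=> _ [M povmM <-].
(* Every POVM is the decoding of a point of [K], so the maximum over [K] bounds them all. *)
rewrite -(boolp.funext (povm_encodeK M)); apply: vmax.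
by apply/mem_set/KE.
Qed.

End Maximum.

Theorem mainTheorem2 (R : realType) (d N : nat) (hN : (0 < N)%N)
    (psi : 'I_N -> 'cV[R[i]]_d) (hpsi : forall x, unit_vector (psi x))
    (p : 'I_N -> R) (hp0 : forall x, 0 <= p x) (hp1 : \sum_(x < N) p x = 1) :
  exists2 Ps : R, is_optimal_success p psi Ps
    & 2 `^ (vn_entropy (ensemble_state p psi)) / N%:R <= Ps.
Proof.
(* The pretty good measurement serves twice: it shows that POVMs exist, and it bounds the optimum
   from below. *)
have [M povmM boundM] := exists_pretty_good hp0 hN hpsi hp1.
have [|Ps optPs] := @exists_optimal_success R d N p psi; first by exists M.
by exists Ps => //; apply: le_trans boundM _; apply: optPs.2; exists M.
Qed.
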